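(* Let $L_1$ be a finite language and $L_2$ a regular language. Then $GSA(L_1,L_2)$ is a regular language.
   Context: For words $w_1,w_2$ and a nonempty word $x$ that is a substring of both, $GSA_x(w_1,w_2)=\{u_1xv_1,u_2xv_2,u_1xv_2,u_2xv_1 : w_1=u_1xv_1,\ w_2=u_2xv_2\}$ over all such factorizations; $GSA(w_1,w_2)=\bigcup_x GSA_x(w_1,w_2)$ over all nonempty common substrings $x$; and $GSA(L_1,L_2)=\bigcup_{w_1\in L_1,w_2\in L_2}GSA(w_1,w_2)$. *)

(* Defs.v *)
From mathcomp Require Import all_boot.
From mathcomp Require Import boolp classical_sets cardinality.
Set Implicit Arguments.
Unset Strict Implicit.
Unset Printing Implicit Defensive.
Local Open Scope classical_set_scope.

Notation word A := (seq A).
Notation language A := (set (word A)).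

Record dfa (A : finType) := Dfa {
  dfa_state : finType;
  dfa_start : dfa_state;
  dfa_final : {set dfa_state};
  dfa_trans : dfa_state -> A -> dfa_state
}.

Definition dfa_language (A : finType) (M : dfa A) : language A :=
  [set w | foldl (@dfa_trans A M) (dfa_start M) w \in dfa_final M].

Definition regular_language (A : finType) (L : language A) : Prop :=
  exists M : dfa A, dfa_language M = L.

Definition GSA_via (A : finType) (x w1 w2 : word A) : language A :=
  [set w | exists u1 v1 u2 v2 : word A,
     [/\ w1 = u1 ++ x ++ v1, w2 = u2 ++ x ++ v2 &
         w \in [:: u1 ++ x ++ v1; u2 ++ x ++ v2;
                   u1 ++ x ++ v2; u2 ++ x ++ v1]]].

(* In seq.v, infix is the contiguous-substring relation (subseq is not). *)
Definition GSA_word (A : finType) (w1 w2 : word A) : language A :=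
  \bigcup_(x in [set x : word A | [&& x != [::], infix x w1 & infix x w2]])
    GSA_via x w1 w2.

Definition GSA (A : finType) (L1 L2 : language A) : language A :=
  \bigcup_(w1 in L1) \bigcup_(w2 in L2) GSA_word w1 w2.

(* Main.v *)
(** Regularity is characterised by the finiteness of the set of left quotients
    (Myhill-Nerode), which makes the closure properties statements about finite
    sets of sets.  For a fixed factorization [w1 = u x v] of a word of [L1], the
    words produced by splicing with [L2] form a union of four languages: a part
    of [{w1}], the words of [L2] containing [x], the concatenation of [{u x}]
    with the right contexts of [x] in [L2], and the concatenation of the left
    contexts of [x] in [L2] with [{x v}].  Each of them is regular, and a finite
    [L1] has finitely many factorizations. *)
Require Import Defs.
From mathcomp Require Import all_boot.
From mathcomp Require Import boolp classical_sets cardinality.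
Set Implicit Arguments.
Unset Strict Implicit.
Unset Printing Implicit Defensive.
Local Open Scope classical_set_scope.

(** Once [D] is listed by a sequence [s], each subset is the image of a boolean set over the finite
    type [seq_sub s]. *)
Lemma finite_powerset (T : choiceType) (D : set T) :
  finite_set D -> finite_set [set E | E `<=` D].
Proof.
move=> /finite_seqP[s ->].
pose f (P : {set seq_sub s}) := [set val y | y in [set` P]].
apply: (@sub_finite_set _ _ (range f)); last exact: finite_image.
move=> E /= sE; exists [set y | `[< E (val y) >]]%SET => //.
apply/seteqP; split=> x /=; first by case=> y; rewrite /= inE => /asboolP Ey <-.
by move=> Ex; exists (SeqSub (sE _ Ex)) => //; rewrite /= inE; apply/asboolP.
Qed.

Section Quotients.
Variable A : finType.
Implicit Types (K L M : language A) (u v w x : word A).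

Definition lquot L u : language A := [set v | L (u ++ v)].

Definition concat K M : language A := [set k ++ m | k in K & m in M].

Lemma lquot_cat L u v : lquot (lquot L u) v = lquot L (u ++ v).
Proof. by apply/funext=> w; rewrite /lquot /= catA. Qed.

Lemma regular_finite_lquot L : regular_language L -> finite_set (range (lquot L)).
Proof.
case=> M <-.
pose f q : language A := [set v | foldl (@dfa_trans A M) q v \in dfa_final M].
apply: (@sub_finite_set _ _ (range f)); last exact: finite_image.
move=> _ [u _ <-]; exists (foldl (@dfa_trans A M) (dfa_start M) u) => //.
by apply/funext=> v; rewrite /lquot /f /dfa_language /= foldl_cat.
Qed.

(** The quotients themselves serve as states: after reading [u] the automaton is in [lquot L u], and
    it accepts when this set contains the empty word. *)
Lemma finite_lquot_regular L : finite_set (range (lquot L)) -> regular_language L.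
Proof.
move=> /finite_seqP[s Es].
have sP u : lquot L u \in s.
  by have : [set` s] (lquot L u) by rewrite -Es; exists u.
pose q0 : seq_sub s := SeqSub (sP [::]).
(* The default [q0] never occurs: a quotient of a quotient of [L] is again one, hence lies in
   [s]. *)
pose step (q : seq_sub s) a := insubd q0 (lquot (val q) [:: a]).
exists (Dfa q0 [set q | `[< val q [::] >]]%SET step).
have run u : val (foldl step q0 u) = lquot L u.
  elim/last_ind: u => [//|u a IHu].
  by rewrite foldl_rcons /step val_insubd IHu lquot_cat cats1 sP.
apply/funext=> u; rewrite /dfa_language /= inE run.
by apply/propext; split=> [/asboolP|Lu]; [|apply/asboolP]; rewrite /lquot /= cats0.
Qed.

Lemma regularP L : regular_language L <-> finite_set (range (lquot L)).
Proof. by split; [exact: regular_finite_lquot|exact: finite_lquot_regular]. Qed.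

(** Every quotient of [L] consists of suffixes of words of [L], and these suffixes form a finite set
    [S]. *)
Lemma finite_regular L : finite_set L -> regular_language L.
Proof.
move=> finL; apply/regularP.
pose S := \bigcup_(w in L) range (fun i : 'I_(size w).+1 => drop i w).
apply: (@sub_finite_set _ _ [set E | E `<=` S]).
  move=> _ [u _ <-] v Luv; exists (u ++ v) => //.
  have lt_u : size u < (size (u ++ v)).+1 by rewrite ltnS size_cat leq_addr.
  by exists (Ordinal lt_u) => //=; rewrite drop_size_cat.
apply: finite_powerset; apply: bigcup_finite => // w _; exact: finite_image.
Qed.

Lemma regularT : regular_language [set: word A].
Proof.
apply/regularP; apply: sub_finite_set (finite_set1 [set: word A]).
by move=> _ [u _ <-]; apply/funext=> v.
Qed.

Lemma regularU K M :
  regular_language K -> regular_language M -> regular_language (K `|` M).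
Proof.
move=> /regularP finK /regularP finM; apply/regularP.
(* Quotients commute with union by conversion. *)
exact: (finite_image11 setU finK finM).
Qed.

Lemma regularI K M :
  regular_language K -> regular_language M -> regular_language (K `&` M).
Proof.
move=> /regularP finK /regularP finM; apply/regularP.
exact: (finite_image11 setI finK finM).
Qed.

Lemma regular_bigcup (T : choiceType) (D : set T) (F : T -> language A) :
  finite_set D -> (forall t, D t -> regular_language (F t)) ->
  regular_language (\bigcup_(t in D) F t).
Proof.
move=> finD regF; rewrite -bigsetU_fset_set// big_seq.
elim/big_ind: _ => [|K M|t]; [exact: finite_regular|exact: regularU|].
by rewrite in_fset_set// inE; exact: regF.
Qed.

(** The union depends only on the image of [S] under [q], a subset of the finite set [range q]. *)
Lemma finite_range_bigcup (I T : Type) (q : I -> set T) :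
  finite_set (range q) -> finite_set (range (fun S => \bigcup_(i in S) q i)).
Proof.
move=> /(@finite_powerset (set T : choiceType)) finq.
apply: sub_finite_set (finite_image (fun E => \bigcup_(X in E) X) finq).
move=> _ [S _ <-]; exists (q @` S); first by move=> _ [i _ <-]; exists i.
by rewrite bigcup_image.
Qed.

(** The removed prefix [u] either ends inside the factor from [K], or covers it and leaves a
    remainder [s] to strip from the factor in [M]. *)
Lemma lquot_concat K M u :
  lquot (concat K M) u = concat (lquot K u) M
    `|` \bigcup_(s in [set s | exists2 k, K k & u = k ++ s]) lquot M s.
Proof.
apply/seteqP; split=> v.
  case=> k Kk [m Mm] Ekm.
  have Eu : u = take (size u) (k ++ m) by rewrite Ekm take_size_cat.
  have Ev : v = drop (size u) (k ++ m) by rewrite Ekm drop_size_cat.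
  move: Eu Ev; rewrite take_cat drop_cat; case: ltnP => [_|le_ku] Eu Ev.
    left; exists (drop (size u) k); first by rewrite /lquot /= {1}Eu cat_take_drop.
    by exists m.
  right; exists (take (size u - size k) m); first by exists k.
  by rewrite /lquot /= Ev cat_take_drop.
case=> [[k Kk [m Mm <-]]|[s [k Kk ->] Msv]].
  by exists (u ++ k) => //; exists m => //; rewrite catA.
by exists k => //; exists (s ++ v) => //; rewrite catA.
Qed.

(** A quotient is determined by a quotient of [K] and a union of quotients of [M]; there are
    finitely many of each. *)
Lemma regular_concat K M :
  regular_language K -> regular_language M -> regular_language (concat K M).
Proof.
move=> /regularP finK /regularP finM; apply/regularP.
have fin2 := finite_image2 (fun X Y => concat X M `|` Y)
  finK (finite_range_bigcup finM).
apply: sub_finite_set fin2 => _ [u _ <-].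
exists (lquot K u); first by exists u.
exists (\bigcup_(s in [set s | exists2 k, K k & u = k ++ s]) lquot M s).
  by eexists.
by rewrite lquot_concat.
Qed.

Lemma regular_right_contexts L x :
  regular_language L -> regular_language [set v | exists u, L (u ++ x ++ v)].
Proof.
move=> /regularP finL; apply/regularP.
apply: sub_finite_set (finite_range_bigcup finL).
(* The quotient by [w] is the union over all [u] of the quotients of [L] by [u ++ x ++ w]. *)
move=> _ [w _ <-]; exists [set u ++ x ++ w | u in [set: word A]] => //.
apply/seteqP; split=> v; rewrite bigcup_image.
  by case=> u _ Lv; exists u; move: Lv; rewrite /lquot /= -!catA.
by case=> u Lv; exists u => //; rewrite /lquot /= -!catA.
Qed.

Lemma regular_left_contexts L x :
  regular_language L -> regular_language [set u | exists v, L (u ++ x ++ v)].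
Proof.
move=> /regularP finL; apply/regularP.
(* Taking left contexts commutes with quotients, so [f] maps the quotients of [L] onto those
   sought. *)
pose f (X : language A) : language A := [set u | exists v, X (u ++ x ++ v)].
apply: sub_finite_set (finite_image f finL) => _ [w _ <-].
exists (lquot L w); first by exists w.
by apply/seteqP; split=> u [v Lv]; exists v; move: Lv; rewrite /lquot /= -!catA.
Qed.

Lemma regular_infix x : regular_language [set w | infix x w].
Proof.
have -> : [set w | infix x w] = concat setT (concat [set x] setT).
  apply/seteqP; split=> w.
    case/infixP=> u [v ->]; exists u => //; exists (x ++ v) => //.
    by exists x => //; exists v.
  by case=> u _ [_ [_ -> [v _ <-]] <-]; apply/infixP; exists u, v.
have regx := finite_regular (finite_set1 x).
exact: regular_concat regularT (regular_concat regx regularT).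
Qed.

(** The pieces follow the order of the four words in [GSA_via]; the first is a singleton or empty,
    according to whether [x] occurs in a word of [L]. *)
Definition splice L (t : word A * word A * word A) : language A :=
  let: (u, x, v) := t in
  [set w | w = u ++ x ++ v /\ exists2 w2, L w2 & infix x w2]
    `|` (L `&` [set w | infix x w])
    `|` concat [set u ++ x] [set v2 | exists u2, L (u2 ++ x ++ v2)]
    `|` concat [set u2 | exists v2, L (u2 ++ x ++ v2)] [set x ++ v].

Lemma regular_splice L t : regular_language L -> regular_language (splice L t).
Proof.
case: t => [[u x] v] regL; do 3?[apply: regularU].
- apply: finite_regular; apply: sub_finite_set (finite_set1 (u ++ x ++ v)).
  by move=> w [].
- exact: regularI (regular_infix x).
- apply: regular_concat (regular_right_contexts _ regL).
  exact: finite_regular.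
- apply: regular_concat (regular_left_contexts _ regL) _.
  exact: finite_regular.
Qed.

Definition factorizations L : set (word A * word A * word A) :=
  [set t | t.1.2 != [::] /\ L (t.1.1 ++ t.1.2 ++ t.2)].

Lemma finite_factorizations L : finite_set L -> finite_set (factorizations L).
Proof.
move=> finL.
(* A factorization of [w] is recovered from the lengths of [u] and [x], both at most [size w]. *)
pose f w (ij : 'I_(size w).+1 * 'I_(size w).+1) :=
  (take ij.1 w, take ij.2 (drop ij.1 w), drop ij.2 (drop ij.1 w)).
apply: (@sub_finite_set _ _ (\bigcup_(w in L) range (f w))).
  move=> [[u x] v] [/= _ Lw]; exists (u ++ x ++ v) => //.
  have lt_u : size u < (size (u ++ x ++ v)).+1 by rewrite ltnS size_cat leq_addr.
  have lt_x : size x < (size (u ++ x ++ v)).+1.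
    by rewrite ltnS !size_cat addnCA leq_addr.
  exists (Ordinal lt_u, Ordinal lt_x) => //.
  by rewrite /f /= take_size_cat// drop_size_cat// take_size_cat// drop_size_cat.
by apply: bigcup_finite => // w _; exact: finite_image.
Qed.

Lemma GSA_splice K L : GSA K L = \bigcup_(t in factorizations K) splice L t.
Proof.
apply/seteqP; split=> w.
  case=> w1 Kw1 [w2 Lw2 [x /= /and3P[x0 _ _] [u1 [v1 [u2 [v2 [Ew1 Ew2]]]]]]].
  have inf2 : infix x w2 by apply/infixP; exists u2, v2.
  subst w1 w2; move=> Ew; exists (u1, x, v1) => //; move: Ew.
  rewrite !inE => /or4P[]/eqP->.
  - by left; left; left; split=> //; exists (u2 ++ x ++ v2).
  - by left; left; right.
  - by left; right; exists (u1 ++ x) => //; exists v2; [exists u2|rewrite catA].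
  - by right; exists u2; [exists v2|exists (x ++ v1)].
case=> [[[u x] v]] [/= x0 Kw1].
(* A single membership criterion serves all four pieces of the converse inclusion. *)
have GSAI y u2 v2 : L (u2 ++ x ++ v2) ->
    y \in [:: u ++ x ++ v; u2 ++ x ++ v2; u ++ x ++ v2; u2 ++ x ++ v] ->
    GSA K L y.
  move=> Lw2 Ey; exists (u ++ x ++ v) => //; exists (u2 ++ x ++ v2) => //.
  exists x; last by exists u, v, u2, v2.
  by apply/and3P; split=> //; apply/infixP; [exists u, v|exists u2, v2].
case=> [[[[-> [w2 Lw2 /infixP[u2 [v2 E2]]]]|[Lw /infixP[u2 [v2 E2]]]]|]|].
- by apply: (GSAI _ u2 v2); rewrite -?E2// !inE eqxx.
- by apply: (GSAI _ u2 v2); rewrite -?E2// !inE E2 eqxx orbT.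
- case=> _ -> [v2 [u2 Lw2] <-]; apply: (GSAI _ u2 v2) => //.
  by rewrite !inE -catA eqxx !orbT.
- case=> u2 [v2 Lw2] [_ -> <-]; apply: (GSAI _ u2 v2) => //.
  by rewrite !inE eqxx !orbT.
Qed.

End Quotients.

Theorem theorem6 (A : finType) (L1 L2 : language A)
    (fin_L1 : finite_set L1) (reg_L2 : regular_language L2) :
  regular_language (GSA L1 L2).
Proof.
rewrite GSA_splice; apply: regular_bigcup; first exact: finite_factorizations.
by move=> t _; exact: regular_splice.
Qed.
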